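(* Let $\mathcal{A}=\left(\frac{-a,-b}{\mathbb{Q}}\right)$ be a rational quaternion division algebra with $a,b>0$, and let $H$ be an order in $\mathcal{A}$. Then $H$ is a left principal ideal domain if and only if for every $\rho\in\mathcal{A}\setminus H$ there exist $\alpha,\beta\in H$ such that $0<\mathrm{N}(\alpha\rho-\beta)<1$.
   Context: $\mathcal{A}$ has $\mathbb{Q}$-basis $1,i,j,k$ with $i^2=-a$, $j^2=-b$, $k=ij=-ji$, and norm $\mathrm{N}(x_0+x_1i+x_2j+x_3k)=x_0^2+ax_1^2+bx_2^2+abx_3^2$. An order $H$ is a subring of $\mathcal{A}$ containing $1$ which is a finitely generated $\mathbb{Z}$-module with $H\otimes_{\mathbb{Z}}\mathbb{Q}=\mathcal{A}$. $H$ is a left principal ideal domain if every left ideal of $H$ is of the form $H\gamma$ for some $\gamma\in H$. *)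

(* Defs.v *)
From HB Require Import structures.
From mathcomp Require Import all_boot all_order all_algebra.
From mathcomp Require Import ring lra.
From mathcomp Require Import boolp classical_sets.

Set Implicit Arguments.
Unset Strict Implicit.
Unset Printing Implicit Defensive.

Import Order.TTheory GRing.Theory Num.Theory.

Local Open Scope ring_scope.

(* The algebra (-a, -b / Q): [Quat x0 x1 x2 x3] stands for
   x0 + x1 i + x2 j + x3 k. *)
Record quat (a b : rat) : Type := Quat { q0 : rat; q1 : rat; q2 : rat; q3 : rat }.

Arguments Quat {a b}.

Section QuaternionAlgebra.
Variables a b : rat.
Local Notation A := (quat a b).
Implicit Types x y z : A.

Definition quat_to_tuple x := (q0 x, q1 x, q2 x, q3 x).
Definition quat_of_tuple (t : rat * rat * rat * rat) : A :=
  Quat t.1.1.1 t.1.1.2 t.1.2 t.2.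

Lemma quat_to_tupleK : cancel quat_to_tuple quat_of_tuple.
Proof. by case. Qed.

HB.instance Definition _ := Choice.copy A (can_type quat_to_tupleK).

Definition quat_zero : A := Quat 0 0 0 0.
Definition quat_opp x : A := Quat (- q0 x) (- q1 x) (- q2 x) (- q3 x).
Definition quat_add x y : A :=
  Quat (q0 x + q0 y) (q1 x + q1 y) (q2 x + q2 y) (q3 x + q3 y).

Lemma quat_addA : associative quat_add.
Proof. by move=> x y z; congr Quat; rewrite /= addrA. Qed.
Lemma quat_addC : commutative quat_add.
Proof. by move=> x y; congr Quat; rewrite /= addrC. Qed.
Lemma quat_add0 : left_id quat_zero quat_add.
Proof. by case=> *; congr Quat; rewrite /= add0r. Qed.
Lemma quat_addN : left_inverse quat_zero quat_opp quat_add.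
Proof. by move=> x; congr Quat; rewrite /= addNr. Qed.

HB.instance Definition _ :=
  GRing.isZmodule.Build A quat_addA quat_addC quat_add0 quat_addN.

(* Obtained by expanding with i^2 = -a, j^2 = -b, ij = -ji = k; hence
   k^2 = -ab, jk = -kj = b i and ki = -ik = a j. *)
Definition quat_one : A := Quat 1 0 0 0.
Definition quat_mul x y : A :=
  Quat
    (q0 x * q0 y - a * (q1 x * q1 y) - b * (q2 x * q2 y)
       - a * b * (q3 x * q3 y))
    (q0 x * q1 y + q1 x * q0 y + b * (q2 x * q3 y - q3 x * q2 y))
    (q0 x * q2 y + q2 x * q0 y + a * (q3 x * q1 y - q1 x * q3 y))
    (q0 x * q3 y + q3 x * q0 y + (q1 x * q2 y - q2 x * q1 y)).

Lemma quat_mulA : associative quat_mul.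
Proof. by move=> x y z; congr Quat => /=; ring. Qed.
Lemma quat_mul1l : left_id quat_one quat_mul.
Proof. by case=> *; congr Quat => /=; ring. Qed.
Lemma quat_mul1r : right_id quat_one quat_mul.
Proof. by case=> *; congr Quat => /=; ring. Qed.
Lemma quat_mulDl : left_distributive quat_mul quat_add.
Proof. by move=> x y z; congr Quat => /=; ring. Qed.
Lemma quat_mulDr : right_distributive quat_mul quat_add.
Proof. by move=> x y z; congr Quat => /=; ring. Qed.
Lemma quat_one_neq0 : quat_one != quat_zero.
Proof. by apply/eqP => -[]. Qed.

HB.instance Definition _ := GRing.Zmodule_isNzRing.Build A
  quat_mulA quat_mul1l quat_mul1r quat_mulDl quat_mulDr quat_one_neq0.

Definition quat_scale (c : rat) x : A :=
  Quat (c * q0 x) (c * q1 x) (c * q2 x) (c * q3 x).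

Lemma quat_scaleA c d x : quat_scale c (quat_scale d x) = quat_scale (c * d) x.
Proof. by congr Quat; rewrite /= mulrA. Qed.
Lemma quat_scale1 : left_id 1 quat_scale.
Proof. by case=> *; congr Quat; rewrite /= mul1r. Qed.
Lemma quat_scaleDr : right_distributive quat_scale +%R.
Proof. by move=> c x y; congr Quat; rewrite /= mulrDr. Qed.
Lemma quat_scaleDl x : {morph quat_scale^~ x : c d / c + d}.
Proof. by move=> c d; congr Quat; rewrite /= mulrDl. Qed.

HB.instance Definition _ := GRing.Zmodule_isLmodule.Build rat A
  quat_scaleA quat_scale1 quat_scaleDr quat_scaleDl.

Lemma quat_scaleAl c x y : c *: (x * y) = (c *: x) * y.
Proof. by congr Quat => /=; ring. Qed.
HB.instance Definition _ := GRing.Lmodule_isLalgebra.Build rat A quat_scaleAl.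

Lemma quat_scaleAr c x y : c *: (x * y) = x * (c *: y).
Proof. by congr Quat => /=; ring. Qed.
HB.instance Definition _ := GRing.Lalgebra_isAlgebra.Build rat A quat_scaleAr.

Definition quat_i : A := Quat 0 1 0 0.
Definition quat_j : A := Quat 0 0 1 0.
Definition quat_k : A := Quat 0 0 0 1.

Lemma quat_basis x :
  x = q0 x *: 1 + q1 x *: quat_i + q2 x *: quat_j + q3 x *: quat_k.
Proof. by case: x => *; congr Quat => /=; ring. Qed.
Lemma quat_i2 : quat_i * quat_i = (- a)%:A.
Proof. by congr Quat => /=; ring. Qed.
Lemma quat_j2 : quat_j * quat_j = (- b)%:A.
Proof. by congr Quat => /=; ring. Qed.
Lemma quat_ij : quat_i * quat_j = quat_k.
Proof. by congr Quat => /=; ring. Qed.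
Lemma quat_ji : quat_j * quat_i = - quat_k.
Proof. by congr Quat => /=; ring. Qed.

Definition qnorm x : rat :=
  q0 x ^+ 2 + a * q1 x ^+ 2 + b * q2 x ^+ 2 + a * b * q3 x ^+ 2.

Definition qconj x : A := Quat (q0 x) (- q1 x) (- q2 x) (- q3 x).

Lemma qnorm_conjr x : x * qconj x = (qnorm x)%:A.
Proof. by rewrite /qnorm; congr Quat => /=; ring. Qed.
Lemma qnorm_conjl x : qconj x * x = (qnorm x)%:A.
Proof. by rewrite /qnorm; congr Quat => /=; ring. Qed.

Lemma qnorm_eq0 x : 0 < a -> 0 < b -> qnorm x = 0 -> x = 0.
Proof.
move=> a_gt0 b_gt0; case: x => x0 x1 x2 x3; rewrite /qnorm /= => /eqP.
have s_ge0 c (y : rat) : 0 < c -> 0 <= c * y ^+ 2.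
  by move=> /ltW c_ge0; rewrite mulr_ge0 // sqr_ge0.
have s_eq0 c (y : rat) : 0 < c -> (c * y ^+ 2 == 0) = (y == 0).
  by move=> c_gt0; rewrite mulf_eq0 gt_eqF //= sqrf_eq0.
have ab_gt0 : 0 < a * b by rewrite mulr_gt0.
rewrite !paddr_eq0 ?addr_ge0 ?s_ge0 ?sqr_ge0 // !s_eq0 // sqrf_eq0.
by move=> /andP[/andP[/andP[/eqP-> /eqP->] /eqP->] /eqP->].
Qed.

(* For a, b > 0 the algebra is automatically a division algebra. *)
Lemma quat_division x : 0 < a -> 0 < b -> x != 0 ->
  exists y, y * x = 1 /\ x * y = 1.
Proof.
move=> a_gt0 b_gt0 x_neq0.
have Nx_neq0 : qnorm x != 0.
  by apply: contra_neq x_neq0; exact: qnorm_eq0.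
exists ((qnorm x)^-1 *: qconj x).
rewrite -scalerAl -scalerAr qnorm_conjl qnorm_conjr scalerA mulVf //.
Qed.

(* H is torsion-free, so the natural map H (x)_Z Q -> A is injective and
   H (x)_Z Q = A amounts to H spanning A over Q. *)
Record is_order (H : set A) : Prop := IsOrder {
  order1 : H 1;
  orderB : forall x y, H x -> H y -> H (x - y);
  orderM : forall x y, H x -> H y -> H (x * y);
  order_fg : exists (m : nat) (s : m.-tuple A), forall x, H x <-> inIntSpan s x;
  order_span : forall x, exists (m : nat) (c : 'I_m -> rat) (h : 'I_m -> A),
    (forall i, H (h i)) /\ x = \sum_(i < m) c i *: h i
}.

Record is_left_ideal (H I : set A) : Prop := IsLeftIdeal {
  left_ideal_sub : (I `<=` H)%classic;
  left_ideal0 : I 0;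
  left_idealB : forall x y, I x -> I y -> I (x - y);
  left_idealM : forall h x, H h -> I x -> I (h * x)
}.

(* "Domain" needs no clause: H lies in a division algebra when a, b > 0. *)
Definition left_pid (H : set A) : Prop :=
  forall I : set A, is_left_ideal H I ->
    exists g : A, H g /\ I = [set h * g | h in H]%classic.

End QuaternionAlgebra.

(* Main.v *)
Require Import Defs.
From HB Require Import structures.
From mathcomp Require Import all_boot all_order all_algebra.
From mathcomp Require Import ring.
From mathcomp Require Import boolp classical_sets.

Set Implicit Arguments.
Unset Strict Implicit.
Unset Printing Implicit Defensive.

Import Order.TTheory GRing.Theory Num.Theory.

Local Open Scope ring_scope.

(* The condition is the Dedekind-Hasse criterion. If it holds, a nonzero element
   of minimal norm generates a left ideal: norms on [H] have bounded
   denominators, so minima exist. Conversely, if [H] is a left PID and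
   [~ H rho], the fractional ideal [H rho + H] is [H gamma] with
   [v gamma = 1] for some [v] in [H], whence [N v * N gamma = 1] and
   [N gamma <= 1]; when [N gamma = 1], [v] has norm 1, so it is a unit of [H],
   and [rho] would lie in [H gamma = H]. *)

(** * Multiplicativity and positivity of the norm; conjugation *)

Section QuaternionNorm.
Variables a b : rat.
Local Notation A := (quat a b).
Implicit Types x y : A.

Lemma quat_mulrn_inj (d : nat) x y : (0 < d)%N -> x *+ d = y *+ d -> x = y.
Proof.
move=> d_gt0; rewrite -!(scaler_nat d) => /(congr1 ( *:%R (d%:R^-1))).
by rewrite !scalerA mulVf ?scale1r // pnatr_eq0 -lt0n.
Qed.

Lemma qnormM x y : qnorm (x * y) = qnorm x * qnorm y.
Proof. by rewrite /qnorm /=; ring. Qed.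

Lemma qnorm1 : qnorm (1 : A) = 1.
Proof. by rewrite /qnorm /=; ring. Qed.

Lemma qconjB x y : qconj (x - y) = qconj x - qconj y.
Proof. by congr Quat => /=; ring. Qed.

Lemma qconjMn x n : qconj (x *+ n) = qconj x *+ n.
Proof. by rewrite -!scaler_nat; congr Quat => /=; ring. Qed.

Lemma qconjM x y : qconj (x * y) = qconj y * qconj x.
Proof. by congr Quat => /=; ring. Qed.

Lemma qconjX x n : qconj (x ^+ n) = qconj x ^+ n.
Proof.
elim: n => [|n IHn]; first by congr Quat => /=; ring.
by rewrite exprS qconjM IHn exprSr.
Qed.

Hypotheses (a_gt0 : 0 < a) (b_gt0 : 0 < b).

Lemma qnorm_ge0 x : 0 <= qnorm x.
Proof.
have [a_ge0 b_ge0] := (ltW a_gt0, ltW b_gt0).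
by rewrite /qnorm !addr_ge0 ?sqr_ge0 // mulr_ge0 ?sqr_ge0 // mulr_ge0.
Qed.

Lemma qnorm_gt0 x : (0 < qnorm x) = (x != 0).
Proof.
rewrite lt_def qnorm_ge0 andbT; apply/idP/idP; apply: contra_neq.
  by move=> ->; rewrite /qnorm /=; ring.
exact: qnorm_eq0.
Qed.

End QuaternionNorm.

Lemma rat_mul_denq (q : rat) : q *+ `|denq q|%N = (numq q)%:~R.
Proof.
rewrite -mulr_natr -[_%:R]/((`|denq q|%N%:Z)%:~R) absz_denq.
by rewrite -{1}(divq_num_den q) divfK // intr_eq0 denq_neq0.
Qed.

(** * Closure properties of additive subgroups *)

Section SubgroupClosure.
Variables (V : zmodType) (P : V -> Prop).
Implicit Types x y : V.
Hypotheses (P_inh : exists x, P x) (PB : forall x y, P x -> P y -> P (x - y)).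

Lemma subgroup0 : P 0.
Proof. by have [x Px] := P_inh; rewrite -(subrr x); apply: PB. Qed.

Lemma subgroupN x : P x -> P (- x).
Proof. by move=> Px; rewrite -sub0r; apply: PB => //; exact: subgroup0. Qed.

Lemma subgroupD x y : P x -> P y -> P (x + y).
Proof. by move=> Px Py; rewrite -(opprK y); apply/PB/subgroupN. Qed.

Lemma subgroup_sum (I : Type) (r : seq I) (F : I -> V) :
  (forall i, P (F i)) -> P (\sum_(i <- r) F i).
Proof.
by move=> PF; apply: big_ind => //; [exact: subgroup0 | exact: subgroupD].
Qed.

Lemma subgroupMn x n : P x -> P (x *+ n).
Proof.
move=> Px; elim: n => [|n IHn]; first by rewrite mulr0n; exact: subgroup0.
by rewrite mulrS; apply: subgroupD.
Qed.

Lemma subgroupMz x z : P x -> P (x *~ z).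
Proof.
by case: z => n Px; [|apply: subgroupN]; apply: subgroupMn.
Qed.

End SubgroupClosure.

(** * Denominators and norms in an order *)

Section Order.
Variables (a b : rat) (H : set (quat a b)).
Hypotheses (a_gt0 : 0 < a) (b_gt0 : 0 < b) (H_order : is_order H).
Local Notation A := (quat a b).
Implicit Types x y : A.

Let H_inh : exists x, H x. Proof. by exists 1; exact: order1. Qed.
Let HB := orderB H_order.
Let HM := orderM H_order.

(** Since [H] spans over the rationals, the product of the denominators of the coefficients of [x]
    serves as [d]. *)
Lemma order_denominator x : exists2 d : nat, (0 < d)%N & H (x *+ d).
Proof.
have [m [c [h [Hh ->]]]] := order_span H_order x.
exists (\prod_(i < m) `|denq (c i)|)%N.
  by apply: prodn_gt0 => i; rewrite absz_gt0 denq_neq0.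
rewrite -sumrMnl; apply: subgroup_sum => // i.
rewrite (bigD1 i) //= mulrnA; apply: subgroupMn => //.
have -> : (c i *: h i) *+ `|denq (c i)| = h i *~ numq (c i).
  by rewrite -scaler_nat scalerA mulr_natl rat_mul_denq scaler_int.
exact: subgroupMz.
Qed.

(** Finite generation of [H] makes denominators uniform: the product of those of the generators
    works for every integer combination of them. *)
Lemma order_uniform_denominator (P : A -> Prop) :
    (forall x y, P x -> P y -> P (x - y)) ->
    (forall x, exists2 d : nat, (0 < d)%N & P (x *+ d)) ->
  exists2 d : nat, (0 < d)%N & forall x, H x -> P (x *+ d).
Proof.
move=> PB Pd; have [m [s Hs]] := order_fg H_order.
have P_inh : exists x, P x by have [d _ Px] := Pd 0; exists (0 *+ d).
have /choice[f fP] (i : 'I_m) : exists d : nat, (0 < d)%N /\ P (s`_i *+ d).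
  by have [d] := Pd s`_i; exists d.
exists (\prod_(i < m) f i)%N; first by apply: prodn_gt0 => i; case: (fP i).
move=> x /Hs[z ->]; rewrite -sumrMnl; apply: subgroup_sum => // i.
rewrite (bigD1 i) //= mulrnA; apply: subgroupMn => //.
by rewrite pmulrn mulrzAC -pmulrn; apply: subgroupMz => //; case: (fP i).
Qed.

Lemma order_conj_denominator :
  exists2 d : nat, (0 < d)%N & forall x, H x -> H (qconj x *+ d).
Proof.
have [] := @order_uniform_denominator (fun x => H (qconj x)).
- by move=> x y Hx Hy; rewrite qconjB; apply: HB.
- move=> x; have [d d_gt0 Hd] := order_denominator (qconj x).
  by exists d; rewrite // qconjMn.
- by move=> d d_gt0 Hd; exists d => // x /Hd; rewrite qconjMn.
Qed.

(* The norm is the real part of [x * qconj x], which lies in [H] up to a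
   uniform denominator. *)
Lemma order_norm_denominator :
  exists2 d : nat, (0 < d)%N & forall x, H x -> qnorm x *+ d \is a Num.int.
Proof.
have q0Mn x n : q0 (x *+ n) = q0 x *+ n.
  by rewrite -scaler_nat -[RHS]mulr_natl.
have [e e_gt0 He] := order_conj_denominator.
have [] := @order_uniform_denominator (fun x => q0 x \is a Num.int).
- by move=> x y; exact: rpredB.
- move=> x; exists `|denq (q0 x)|%N; first by rewrite absz_gt0 denq_neq0.
  by rewrite q0Mn rat_mul_denq intr_int.
move=> d d_gt0 Hd; exists (e * d)%N; first by rewrite muln_gt0 e_gt0.
move=> x Hx; have := Hd _ (HM Hx (He x Hx)).
by rewrite mulrnAr qnorm_conjr -mulrnA q0Mn /= mulr1.
Qed.

(** Multiplied by one fixed [d], all norms on [I] become natural numbers, so well-ordering gives a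
    minimum. *)
Lemma order_min_norm (I : set A) : (forall x, I x -> H x) ->
    (exists2 x, I x & x != 0) ->
  exists g, [/\ I g, g != 0 &
    forall x, I x -> x != 0 -> qnorm g <= qnorm x].
Proof.
move=> IH [x0 Ix0 x0_neq0]; have [d d_gt0 Hd] := order_norm_denominator.
have norm_nat x : I x -> exists n : nat, qnorm x *+ d = n%:R.
  move=> /IH/Hd xd; apply/natrP.
  by rewrite natrEint xd mulrn_wge0 ?qnorm_ge0.
pose P n := `[< exists x, [/\ I x, x != 0 & qnorm x *+ d = n%:R] >].
have exP : exists n, P n.
  by have [n nE] := norm_nat x0 Ix0; exists n; apply/asboolP; exists x0.
have [n /asboolP[g [Ig g_neq0 gE]] n_min] := ex_minnP exP.
exists g; split => // x Ix x_neq0; have [k kE] := norm_nat x Ix.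
have : (n <= k)%N by apply: n_min; apply/asboolP; exists x.
by rewrite -(ler_nat rat) -gE -kE lerMn2r eqn0Ngt d_gt0.
Qed.

(** If [g] has minimal norm among the nonzero elements of [H], then [x * g] is again such an
    element, so [qnorm g <= qnorm x * qnorm g]; cancel [qnorm g]. *)
Lemma order_norm_ge1 x : H x -> x != 0 -> 1 <= qnorm x.
Proof.
move=> Hx x_neq0.
have [|g [Hg g_neq0 g_min]] := order_min_norm (fun x (Hx : H x) => Hx).
  by exists 1; [exact: order1 | exact: oner_neq0].
have g_gt0 : 0 < qnorm g by rewrite qnorm_gt0.
have xg_neq0 : x * g != 0.
  by rewrite -(qnorm_gt0 a_gt0 b_gt0) qnormM mulr_gt0 // qnorm_gt0.
have := g_min _ (HM Hx Hg) xg_neq0.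
by rewrite qnormM ler_pMl.
Qed.

(* Up to a common denominator, the modules [H * v^-n] form an increasing chain
   of left ideals of [H]; it stops because its union is principal. *)
Lemma order_norm1_conj v : left_pid H -> H v -> qnorm v = 1 -> H (qconj v).
Proof.
move=> pidH Hv Nv; set w := qconj v.
have vw : v * w = 1 by rewrite qnorm_conjr Nv scale1r.
have wv : w * v = 1 by rewrite qnorm_conjl Nv scale1r.
have HX n : H (v ^+ n).
  elim: n => [|n IHn]; first exact: order1.
  by rewrite exprS; apply: HM.
have vwX n : v ^+ n * w ^+ n = 1.
  elim: n => [|n IHn]; first by rewrite !expr0 mulr1.
  by rewrite exprSr exprS mulrA -[_ * v * w]mulrA vw mulr1.
have wvX n : w ^+ n * v ^+ n = 1.
  elim: n => [|n IHn]; first by rewrite !expr0 mulr1.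
  by rewrite exprSr exprS mulrA -[_ * w * v]mulrA wv mulr1.
have [d d_gt0 Hd] := order_conj_denominator.
pose I : set A := fun x => exists n h, H h /\ x = (h * w ^+ n) *+ d.
have I_ideal : is_left_ideal H I.
  split.
  (* One [d] serves all [n], because [w ^+ n] is the conjugate of [v ^+ n], an element of [H]. *)
  - move=> _ [n [h [Hh ->]]]; rewrite -mulrnAr -qconjX.
    exact/HM/Hd.
  - by exists 0, 0; split; [exact: subgroup0 | rewrite mul0r mul0rn].
  - move=> _ _ [n [h [Hh ->]]] [m [k [Hk ->]]].
    (* Both terms are moved to stage [m + n] of the chain, using
       [h * w ^+ n = h * v ^+ m * w ^+ (m + n)]. *)
    exists (m + n)%N, (h * v ^+ m - k * v ^+ n); split.
      by apply: HB; apply: HM.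
    rewrite mulrBl {1}exprD addnC exprD -mulrnBl !mulrA.
    by rewrite -(mulrA h (v ^+ m)) -(mulrA k (v ^+ n)) !vwX !mulr1.
  - move=> h _ Hh [n [k [Hk ->]]]; exists n, (h * k).
    by split; [exact: HM | rewrite mulrnAr mulrA].
have [g [Hg IE]] := pidH I I_ideal.
have [n [h [Hh gE]]] : I g.
  by rewrite IE; exists 1; [exact: order1 | rewrite mul1r].
(* The generator already lies at stage [n], so stage [n.+1] brings nothing new:
   [w ^+ n.+1 = u * h * w ^+ n]. Cancelling [w ^+ n] leaves [w = u * h]. *)
have : I (w ^+ n.+1 *+ d).
  by exists n.+1, 1; rewrite mul1r; split => //; exact: order1.
rewrite IE => -[u Hu]; rewrite gE mulrnAr => /(quat_mulrn_inj d_gt0).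
move=> /(congr1 (fun x => x * v ^+ n)).
rewrite exprS -!mulrA wvX !mulr1 => <-.
exact: HM.
Qed.

(** * The two implications of the criterion *)

Lemma dedekind_hasse_left_pid :
  (forall rho, ~ H rho -> exists alpha beta,
     [/\ H alpha, H beta & 0 < qnorm (alpha * rho - beta) < 1]) ->
  left_pid H.
Proof.
move=> DH I [IH I0 IB IM].
have [[x Ix x_neq0]|I_triv] := pselect (exists2 x, I x & x != 0); last first.
  exists 0; split; first exact: subgroup0.
  apply/seteqP; split => [x Ix|_ [h _ <-]]; last by rewrite mulr0.
  exists 0; first exact: subgroup0.
  rewrite mul0r; apply/esym/eqP/negPn/negP => x_neq0.
  by apply: I_triv; exists x.
have [|g [Ig g_neq0 g_min]] := order_min_norm IH; first by exists x.
exists g; split; first exact: IH.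
have [g' [g'g _]] := quat_division a_gt0 b_gt0 g_neq0.
apply/seteqP; split => [y Iy|_ [h Hh <-]]; last exact: IM.
(* If the quotient [y * g'] were outside [H], the hypothesis applied to it and multiplied by [g]
   would give a nonzero element [al * y - be * g] of [I] with norm below that of [g]. *)
exists (y * g'); last by rewrite -mulrA g'g mulr1.
apply: contrapT => /DH[al [be [Hal Hbe /andP[N_gt0 N_lt1]]]].
have Ng_gt0 : 0 < qnorm g by rewrite qnorm_gt0.
have NE : qnorm (al * y - be * g) = qnorm (al * (y * g') - be) * qnorm g.
  by rewrite -qnormM mulrBl -!mulrA g'g mulr1.
have : qnorm g <= qnorm (al * y - be * g).
  apply: g_min; first by apply: IB; apply: IM.
  by rewrite -(qnorm_gt0 a_gt0 b_gt0) NE mulr_gt0.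
by rewrite NE ler_pMl // leNgt N_lt1.
Qed.

Lemma left_pid_dedekind_hasse rho : left_pid H -> ~ H rho ->
  exists alpha beta,
    [/\ H alpha, H beta & 0 < qnorm (alpha * rho - beta) < 1].
Proof.
move=> pidH Hrho; have [d d_gt0 Hd] := order_denominator rho.
(* The fractional ideal [H rho + H], scaled by [d] to lie inside [H]. Its generator is
   [g = ga *+ d], and cancelling [d] shows that [ga] generates the fractional ideal. *)
pose I : set A := fun x => exists al be,
  [/\ H al, H be & x = (al * rho + be) *+ d].
have H0 : H 0 by exact: subgroup0.
have I_ideal : is_left_ideal H I.
  split.
  - move=> _ [al [be [Hal Hbe ->]]]; rewrite mulrnDl -mulrnAr.
    by apply: subgroupD => //; [exact: HM | exact: subgroupMn].
  - by exists 0, 0; rewrite mul0r addr0 mul0rn.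
  - move=> _ _ [al [be [Hal Hbe ->]]] [al' [be' [Hal' Hbe' ->]]].
    exists (al - al'), (be - be'); split; [exact: HB | exact: HB |].
    by rewrite mulrBl -mulrnBl opprD addrACA.
  - move=> h _ Hh [al [be [Hal Hbe ->]]]; exists (h * al), (h * be).
    by split; [exact: HM | exact: HM | rewrite mulrnAr mulrDr mulrA].
have [g [Hg IE]] := pidH I I_ideal.
have [al [be [Hal Hbe gE]]] : I g.
  by rewrite IE; exists 1; [exact: order1 | rewrite mul1r].
set ga := al * rho + be in gE.
have [v Hv vga] : exists2 v, H v & v * ga = 1.
  have : I (1 *+ d) by exists 0, 1; rewrite mul0r add0r; split=> //; exact: order1.
  rewrite IE => -[v Hv]; rewrite gE mulrnAr => /(quat_mulrn_inj d_gt0).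
  by exists v.
have [u Hu uga] : exists2 u, H u & u * ga = rho.
  have : I (rho *+ d) by exists 1, 0; rewrite mul1r addr0; split=> //; exact: order1.
  rewrite IE => -[u Hu]; rewrite gE mulrnAr => /(quat_mulrn_inj d_gt0).
  by exists u.
have Nvga : qnorm v * qnorm ga = 1 by rewrite -qnormM vga qnorm1.
have ga_neq0 : ga != 0.
  by apply: contra_eq_neq vga => ->; rewrite mulr0 eq_sym oner_neq0.
have v_neq0 : v != 0.
  by apply: contra_eq_neq vga => ->; rewrite mul0r eq_sym oner_neq0.
have ga_gt0 : 0 < qnorm ga by rewrite qnorm_gt0.
have v_gt0 : 0 < qnorm v by rewrite qnorm_gt0.
(* If [ga] has norm below 1, it is itself the required element [al * rho - (- be)]. *)
have [ga_lt1|ga_ge1] := ltP (qnorm ga) 1.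
  exists al, (- be); split => //; first exact: subgroupN.
  by rewrite opprK ga_gt0.
case: Hrho; have Nv : qnorm v = 1.
  apply/le_anti/andP; split; last exact: order_norm_ge1.
  by rewrite -Nvga ler_pMr.
(* With [qnorm v = 1] and [v * ga = 1], the inverse [ga] of [v] is [qconj v], which lies in [H]. *)
suff -> : rho = u * qconj v by apply/HM/order_norm1_conj.
by rewrite -uga -[ga]mul1r -[1](scale1r) -Nv -qnorm_conjl -mulrA vga mulr1.
Qed.

End Order.

Theorem theorem3p1 (a b : rat) (a_gt0 : 0 < a) (b_gt0 : 0 < b)
    (H : set (quat a b)) (H_order : is_order H) :
  left_pid H <->
  (forall rho : quat a b, ~ H rho ->
     exists alpha beta : quat a b,
       [/\ H alpha, H beta & 0 < qnorm (alpha * rho - beta) < 1]).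
Proof.
split => [pidH rho|]; first exact: left_pid_dedekind_hasse.
exact: dedekind_hasse_left_pid.
Qed.
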